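(* The following six mesh patterns $(12,R)$ are pairwise equidistributed, where $R$ ranges over: $\{(0,2),(1,2),(2,2),(0,1),(1,1),(2,1)\}$, $\{(0,2),(1,2),(0,1),(1,1),(0,0),(1,0)\}$, $\{(1,2),(2,2),(1,1),(2,1),(1,0),(2,0)\}$, $\{(0,1),(1,1),(2,1),(0,0),(1,0),(2,0)\}$, $\{(0,2),(2,2),(0,1),(2,1),(0,0),(2,0)\}$, $\{(0,2),(1,2),(2,2),(0,0),(1,0),(2,0)\}$. Moreover, for each such pattern $p$, $s_{0,0}(p)=s_{1,0}(p)=1$, and for $n\ge2$, $s_{n,0}(p)=n!/2$ and $s_{n,1}(p)=n!/2$. Equivalently, $$\sum_{n\ge0}x^n\sum_{\pi\in S_n}q^{p(\pi)}=\frac{(1-q)(1+x)}{2}+\frac{1+q}{2}F(x),\qquad F(x)=\sum_{n\ge0}n!\,x^n.$$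
   Context: For $R\subseteq\{0,1,2\}^2$ and $\pi=\pi_1\cdots\pi_n\in S_n$, an occurrence of the mesh pattern $(12,R)$ in $\pi$ is a pair of positions $i_1<i_2$ with $\pi_{i_1}<\pi_{i_2}$ such that, setting $x_0=0,x_1=i_1,x_2=i_2,x_3=n+1$ and $y_0=0,y_1=\pi_{i_1},y_2=\pi_{i_2},y_3=n+1$, for every $(a,b)\in R$ there is no index $k$ with $x_a<k<x_{a+1}$ and $y_b<\pi_k<y_{b+1}$. $p(\pi)$ is the number of occurrences of $p$ in $\pi$; $s_{n,k}(p)$ the number of $\pi\in S_n$ with $p(\pi)=k$; $p_1,p_2$ are equidistributed if $s_{n,k}(p_1)=s_{n,k}(p_2)$ for all $n,k\ge 0$. Generating functions are formal power series. *)

(* Defs.v *)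
From mathcomp Require Import all_boot all_order all_fingroup all_algebra.

Set Implicit Arguments.
Unset Strict Implicit.
Unset Printing Implicit Defensive.

Import GRing.Theory.

(* A shading R of the 3 x 3 grid; the box (a, b) is in column a and row b.
   The mesh pattern (12, R) is represented by R. *)
Definition shading := {set 'I_3 * 'I_3}.

Definition boxes (s : seq (nat * nat)) : shading :=
  [set c : 'I_3 * 'I_3 | (val c.1, val c.2) \in s].

(* Elements of 'I_n are 0-based, whereas positions and values are 1-based:
   position k and value pi k stand for k.+1 and (pi k).+1. *)
Definition xgrid n (i1 i2 : 'I_n) : seq nat := [:: 0; i1.+1; i2.+1; n.+1].
Definition ygrid n (pi : 'S_n) (i1 i2 : 'I_n) : seq nat :=
  [:: 0; (pi i1).+1; (pi i2).+1; n.+1].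

Definition in_box n (pi : 'S_n) (i1 i2 : 'I_n) (a b : nat) (k : 'I_n) : bool :=
  let x := nth 0 (xgrid i1 i2) in
  let y := nth 0 (ygrid pi i1 i2) in
  (x a < k.+1 < x a.+1) && (y b < (pi k).+1 < y b.+1).

Definition is_occurrence (R : shading) n (pi : 'S_n) (i1 i2 : 'I_n) : bool :=
  [&& i1 < i2, pi i1 < pi i2 &
      [forall c in R, ~~ [exists k, in_box pi i1 i2 c.1 c.2 k]]].

Definition occurrences (R : shading) n (pi : 'S_n) : nat :=
  #|[set i : 'I_n * 'I_n | is_occurrence R pi i.1 i.2]|.

Definition s_ (n k : nat) (R : shading) : nat :=
  #|[set pi : 'S_n | occurrences R pi == k]|.

Definition equidistributed (R1 R2 : shading) : Prop :=
  forall n k : nat, s_ n k R1 = s_ n k R2.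

Definition the_patterns : seq shading :=
  [:: boxes [:: (0, 2); (1, 2); (2, 2); (0, 1); (1, 1); (2, 1)];
      boxes [:: (0, 2); (1, 2); (0, 1); (1, 1); (0, 0); (1, 0)];
      boxes [:: (1, 2); (2, 2); (1, 1); (2, 1); (1, 0); (2, 0)];
      boxes [:: (0, 1); (1, 1); (2, 1); (0, 0); (1, 0); (2, 0)];
      boxes [:: (0, 2); (2, 2); (0, 1); (2, 1); (0, 0); (2, 0)];
      boxes [:: (0, 2); (1, 2); (2, 2); (0, 0); (1, 0); (2, 0)]].

Local Open Scope ring_scope.

(* Formal power series in x over A, as coefficient sequences.  Their product is
   the Cauchy product, not the pointwise product of functions. *)
Section FormalPowerSeries.
Variable A : nzRingType.
Implicit Types (f g : nat -> A) (c : A).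

Definition fps_const c : nat -> A := fun n => if n == 0%N then c else 0.
Definition fps_x : nat -> A := fun n => if n == 1%N then 1 else 0.
Definition fps_add f g : nat -> A := fun n => f n + g n.
Definition fps_mul f g : nat -> A := fun n => \sum_(i < n.+1) f i * g (n - i)%N.
End FormalPowerSeries.

Declare Scope fps_scope.
Delimit Scope fps_scope with fps.
Notation "c %:S" := (fps_const c) (at level 2, format "c %:S") : fps_scope.
Notation "\x" := (fps_x _) (at level 0) : fps_scope.
Notation "f + g" := (fps_add f g) : fps_scope.
Notation "f * g" := (fps_mul f g) : fps_scope.

(* The variable q is 'X, so the coefficients live in Q[q]. *)
Definition F : nat -> {poly rat} := fun n => (n`!)%:R.

Definition pattern_gf (R : shading) : nat -> {poly rat} :=
  fun n => \sum_(pi : 'S_n) 'X ^+ occurrences R pi.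

(* Main.v *)
Require Import Defs.
From mathcomp Require Import all_boot all_order all_fingroup all_algebra zify.

Set Implicit Arguments.
Unset Strict Implicit.
Unset Printing Implicit Defensive.

Import GRing.Theory.
Local Open Scope ring_scope.

(** Each of the six shadings consists of two full columns or two full rows. For
    [n >= 2] this forces the pair of positions (for columns) or of values (for
    rows) of an occurrence to be a fixed pair [a < b]; so a permutation [pi] has
    at most one occurrence, and it has one iff [pi a < pi b] (for columns) or
    [pi^-1 a < pi^-1 b] (for rows). Composing with the transposition of [a] and
    [b] shows that exactly half of the permutations satisfy this. *)

(** The strips are cut out by [u] and [v] alone, with no permutation involved. Since
    [ygrid pi i1 i2] unfolds to [xgrid (pi i1) (pi i2)], the same predicate serves for columns at a
    pair of positions and for rows at a pair of values. *)
Definition empty_strips (j : 'I_3) n (u v : 'I_n) : bool :=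
  [forall a : 'I_3, (a != j) ==>
    [forall k : 'I_n, ~~ (nth 0 (xgrid u v) a < k.+1 < nth 0 (xgrid u v) a.+1)%N]].

Lemma mem_strip n (u v k : 'I_n) : (u < v)%N -> k != u -> k != v ->
  exists a : 'I_3, (nth 0 (xgrid u v) a < k.+1 < nth 0 (xgrid u v) a.+1)%N.
Proof.
move=> uv; rewrite -!val_eqE /= => ku kv; have := ltn_ord k.
case: (ltnP k u) => [ltku|leuk] ltkn; first by exists 0; rewrite /= !ltnS.
case: (ltnP k v) => [ltkv|levk].
  by exists (inord 1); rewrite inordK //=; lia.
by exists (inord 2); rewrite inordK //=; lia.
Qed.

Lemma strip_neq n (u v k : 'I_n) (a : 'I_3) : (u < v)%N ->
  (nth 0 (xgrid u v) a < k.+1 < nth 0 (xgrid u v) a.+1)%N -> k != u /\ k != v.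
Proof.
by case: a => [[|[|[|//]]] lta] /= uv ka; rewrite -!val_eqE /=; split; lia.
Qed.

(** A position inside a shaded column differs from [i1] and [i2], so its value differs from both
    pattern values and lies in some row; the box where the two meet is shaded because the whole
    column is. *)
Lemma is_occurrence_columns (R : shading) (j : 'I_3) n (pi : 'S_n) (i1 i2 : 'I_n) :
  (forall c, (c \in R) = (c.1 != j)) ->
  is_occurrence R pi i1 i2 = [&& i1 < i2, pi i1 < pi i2 & empty_strips j i1 i2]%N.
Proof.
move=> defR; rewrite /is_occurrence.
case: ltnP => //= lti; case: ltnP => //= ltpi.
apply/forall_inP/'forall_implyP => [empR a neqaj | emp c].
  apply/forallP => k; apply/negP => ka; have [k1 k2] := strip_neq lti ka.
  have [|| b kb] := mem_strip (k := pi k) ltpi; rewrite ?(inj_eq perm_inj) //.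
  have /negP[] := empR (a, b) ltac:(by rewrite defR).
  by apply/existsP; exists k; rewrite /in_box /= ka.
rewrite defR => /emp/forallP empc; apply/existsPn => k.
by rewrite /in_box negb_and empc.
Qed.

Lemma is_occurrence_rows (R : shading) (j : 'I_3) n (pi : 'S_n) (i1 i2 : 'I_n) :
  (forall c, (c \in R) = (c.2 != j)) ->
  is_occurrence R pi i1 i2 =
    [&& i1 < i2, pi i1 < pi i2 & empty_strips j (pi i1) (pi i2)]%N.
Proof.
move=> defR; rewrite /is_occurrence.
case: ltnP => //= lti; case: ltnP => //= ltpi.
apply/forall_inP/'forall_implyP => [empR b neqbj | emp c].
  (* Every value [l] is attained, at position [k]; the column argument then applies with the axes
     exchanged. *)
  apply/forallP => l; apply/negP; rewrite -(permKV pi l); move: (pi^-1%g l) => k kb.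
  have [] := strip_neq ltpi kb; rewrite !(inj_eq perm_inj) => k1 k2.
  have [a ka] := mem_strip lti k1 k2.
  have /negP[] := empR (a, b) ltac:(by rewrite defR).
  by apply/existsP; exists k; rewrite /in_box /= ka.
rewrite defR => /emp/forallP empc; apply/existsPn => k.
by rewrite /in_box negb_and orbC empc.
Qed.

Lemma empty_stripsE (j : 'I_3) n (u v : 'I_n) : (u < v)%N ->
  empty_strips j u v =
    [&& (j == 0 :> nat) || (u == 0 :> nat),
        (j == 1 :> nat) || (v == u.+1 :> nat)
      & (j == 2 :> nat) || (v.+1 == n)]%N.
Proof.
move=> ltuv; have ltvn := ltn_ord v; apply/'forall_implyP/and3P => [emp | [h0 h1 h2] a].
  have e (a : 'I_3) k : (k < n)%N -> (a != j :> nat) ->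
      ~~ (nth 0 (xgrid u v) a < k.+1 < nth 0 (xgrid u v) a.+1)%N.
    by move=> ltkn /emp/forallP/(_ (Ordinal ltkn)).
  split.
  (* One test point per strip is enough: 0, the successor of [u], and [n.-1] lie in strips 0, 1 and
     2 respectively whenever these are nonempty. *)
  - by have := e ord0 0; rewrite /=; lia.
  - by have := e (inord 1) u.+1; rewrite inordK //=; lia.
  - by have := e (inord 2) n.-1; rewrite inordK //=; lia.
rewrite -val_eqE; case: a => [[|[|[|//]]] lta] /= aj; apply/forallP => k;
  have := ltn_ord k; lia.
Qed.

Lemma empty_strips_unique (j : 'I_3) n : (2 <= n)%N ->
  exists a b : 'I_n, (a < b)%N /\
    forall u v : 'I_n, (u < v)%N -> empty_strips j u v = (u == a) && (v == b).
Proof.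
case: n => [|[|n]] // _.
have ltn0 : (n < n.+2)%N by lia.
(* With [n] now standing for the size minus 2, the pairs are the last two points for [j = 0], the
   two extreme points for [j = 1], and the first two points for [j = 2]. *)
case: j => [[|[|[|//]]] ltj]; [exists (Ordinal ltn0), ord_max
  | exists ord0, ord_max | exists ord0, (Ordinal (isT : 1 < n.+2)%N)];
  (split=> [|u v ltuv]; first by rewrite /=; lia);
  rewrite empty_stripsE // -!val_eqE /=; have := ltn_ord v; lia.
Qed.

Lemma card_perm_lt n (a b : 'I_n) : a != b ->
  (#|[set pi : 'S_n | (pi a < pi b)%N]|.*2 = n`!)%N.
Proof.
move=> neqab; set A := [set _ | _].
have eqc : #|A| = #|~: A|.
  rewrite -(card_imset _ (mulgI (tperm a b))); apply: eq_card => pi.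
  apply/imsetP/idP => [[s As ->]|nApi].
    by move: As; rewrite !inE !permM tpermL tpermR -leqNgt => /ltnW.
  exists (tperm a b * pi)%g; last by rewrite mulgA tperm2 mul1g.
  move: nApi; rewrite !inE !permM tpermL tpermR -leqNgt leq_eqVlt => /orP[|//].
  by rewrite val_eqE (inj_eq perm_inj) eq_sym (negbTE neqab).
by rewrite -addnn {2}eqc cardsC card_Sn.
Qed.

Lemma card_permV_lt n (a b : 'I_n) : a != b ->
  (#|[set pi : 'S_n | (pi^-1%g a < pi^-1%g b)%N]|.*2 = n`!)%N.
Proof.
move=> neqab; rewrite -(card_perm_lt neqab); congr _.*2.
rewrite -[LHS](card_preimset _ invg_inj); apply: eq_card => pi.
by rewrite !inE invgK.
Qed.

(** Here [j] is the one column, or row, left unshaded. *)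
Lemma the_patterns_lines (R : shading) : R \in the_patterns ->
  exists j : 'I_3, (forall c, (c \in R) = (c.1 != j)) \/
                   (forall c, (c \in R) = (c.2 != j)).
Proof.
rewrite !inE => /orP[/eqP->|/orP[/eqP->|/orP[/eqP->|/orP[/eqP->|/orP[]/eqP->]]]];
  [exists ord0; right | exists ord_max; left | exists ord0; left
  | exists ord_max; right | exists (inord 1); left | exists (inord 1); right];
  by case=> [[[|[|[|//]]] a3] [[|[|[|//]]] b3]]; rewrite inE -val_eqE /= ?inordK.
Qed.

Lemma occurrences_small (R : shading) n (pi : 'S_n) : (n < 2)%N ->
  occurrences R pi = 0%N.
Proof.
move=> ltn2; apply/eqP; rewrite cards_eq0 -subset0; apply/subsetP => -[u v].
by rewrite inE => /and3P[/=]; have := ltn_ord v; lia.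
Qed.

(** Used once the empty strips leave a single candidate pair: the number of occurrences becomes the
    truth value of the remaining order condition. *)
Lemma card_unique_pair (T : finType) (a b : T) (P : rel T) :
  #|[set i : T * T | [&& i.1 == a, i.2 == b & P i.1 i.2]]| = P a b.
Proof.
case Pab: (P a b); last first.
  apply/eqP; rewrite cards_eq0 -subset0; apply/subsetP => -[u v].
  by rewrite !inE /= => /and3P[/eqP-> /eqP->]; rewrite Pab.
rewrite -[RHS](cards1 (a, b)); apply: eq_card => -[u v].
by rewrite !inE /= xpair_eqE; case: eqP => //= ->; case: eqP => //= ->.
Qed.

Lemma occurrences_half (R : shading) n : R \in the_patterns -> (2 <= n)%N ->
  exists2 A : {set 'S_n}, (forall pi, occurrences R pi = (pi \in A)) &
    (#|A|.*2 = n`!)%N.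
Proof.
move=> /the_patterns_lines[j defR] n2.
have [a [b [ltab ab_unique]]] := empty_strips_unique j n2.
have neqab : a != b by rewrite -val_eqE /=; lia.
case: defR => [columns | rows].
  exists [set pi : 'S_n | (pi a < pi b)%N]; last exact: card_perm_lt.
  move=> pi; rewrite inE -(card_unique_pair a b (fun u v => pi u < pi v)%N).
  apply: eq_card => -[u v]; rewrite !inE /= (is_occurrence_columns _ _ _ columns).
  case: ltnP => [ltuv|leuv]; first by rewrite ab_unique //= andbC -andbA.
  by case: eqP => //= eu; case: eqP => //= ev; move: leuv; rewrite eu ev leqNgt ltab.
exists [set pi : 'S_n | (pi^-1%g a < pi^-1%g b)%N]; last exact: card_permV_lt.
move=> pi; set x := pi^-1%g a; set y := pi^-1%g b.
rewrite inE -(card_unique_pair x y (fun u v => u < v)%N).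
apply: eq_card => -[u v]; rewrite !inE /= (is_occurrence_rows _ _ _ rows).
(* Here the strips determine the values [pi u = a] and [pi v = b], hence the positions [x] and [y];
   the condition left over is [x < y]. *)
rewrite -!(can2_eq (permK pi) (permKV pi)).
case: (ltnP (pi u) (pi v)) => [ltuv|leuv]; first by rewrite ab_unique //= andbC -andbA.
rewrite andbF; case: eqP => //= eu; case: eqP => //= ev.
by move: leuv; rewrite eu ev leqNgt ltab.
Qed.

Lemma s_small n k (R : shading) : (n < 2)%N -> s_ n k R = (k == 0%N).
Proof.
move=> n2; rewrite /s_; case: k => [|k].
  transitivity #|'S_n|; last by rewrite card_Sn; case: n n2 => [|[]].
  by apply: eq_card => pi; rewrite inE occurrences_small.
by apply/eqP; rewrite cards_eq0 -subset0; apply/subsetP => pi; rewrite inE occurrences_small.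
Qed.

(** The counts for [k = 0] and [k = 1] are those of the complement of [A] and of [A], which have
    equal size. Doubling avoids division in [nat], and the right-hand side does not mention [R],
    which yields equidistribution. *)
Lemma s_double n k (R : shading) : R \in the_patterns -> (2 <= n)%N ->
  ((s_ n k R).*2 = (k < 2) * n`!)%N.
Proof.
move=> /occurrences_half/[apply] -[A occA dblA].
have -> : s_ n k R = #|[set pi | (pi \in A) == k :> nat]|.
  by apply: eq_card => pi; rewrite !inE occA.
case: k => [|[|k]] /=; rewrite ?mul1n ?mul0n.
- have -> : [set pi | (pi \in A) == 0 :> nat] = ~: A.
    by apply/setP => pi; rewrite !inE; case: (pi \in A).
  by move: (cardsC A); rewrite card_Sn -dblA -!addnn => /addnI->.
- rewrite -dblA; congr _.*2; apply: eq_card => pi; rewrite inE.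
  by case: (pi \in A).
apply/eqP; rewrite double_eq0 cards_eq0 -subset0; apply/subsetP => pi.
by rewrite inE; case: (pi \in A).
Qed.

Lemma fps_mul_constE (A : nzRingType) (c : A) (f : nat -> A) n :
  fps_mul (fps_const c) f n = c * f n.
Proof.
rewrite /fps_mul big_ord_recl subn0 big1 ?addr0 // => i _.
by rewrite /fps_const /= mul0r.
Qed.

Lemma pattern_gf_small (R : shading) n : (n < 2)%N -> pattern_gf R n = 1.
Proof.
move=> n2; rewrite /pattern_gf (eq_bigr (fun=> 1)) => [|pi _].
  by rewrite sumr_const card_Sn; case: n n2 => [|[]].
by rewrite occurrences_small.
Qed.

Lemma pattern_gf_large (R : shading) n : R \in the_patterns -> (2 <= n)%N ->
  pattern_gf R n = (2%:R^-1 *: (1 + 'X)) * F n.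
Proof.
move=> /occurrences_half/[apply] -[A occA dblA].
(* Permutations in [A] contribute ['X] and the others 1, so the sum is [#|A|] times [1 + 'X], while
   [F n] is twice [#|A|]. *)
rewrite /pattern_gf (bigID (mem A)) /=.
rewrite (eq_bigr (fun=> 'X)); last by move=> pi pA; rewrite occA pA expr1.
rewrite [X in _ + X](eq_bigr (fun=> 1)); last first.
  by move=> pi /negbTE pA; rewrite occA pA expr0.
rewrite !sumr_const.
have -> : #|[predC A]| = #|A| by move: (cardC A); rewrite card_Sn -dblA -addnn => /addnI.
rewrite /F -dblA mulr_natr -mul2n mulrnA -[_ *+ 2]scaler_nat scalerA mulfV //.
by rewrite scale1r -mulrnDl addrC.
Qed.

Theorem theorem3p7 :
  (forall R1 R2 : shading, R1 \in the_patterns -> R2 \in the_patterns ->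
     equidistributed R1 R2) /\
  (forall R : shading, R \in the_patterns ->
     [/\ s_ 0 0 R = 1%N, s_ 1 0 R = 1%N,
         forall n : nat, (2 <= n)%N ->
           (s_ n 0 R)%:R = n`!%:R / 2%:R :> rat /\
           (s_ n 1 R)%:R = n`!%:R / 2%:R :> rat
       & pattern_gf R =1
           ((2%:R^-1 *: (1 - 'X))%:S * (1%:S + \x)
            + (2%:R^-1 *: (1 + 'X))%:S * F)%fps]).
Proof.
split=> [R1 R2 R1p R2p n k | R Rp].
  have [n2|n2] := ltnP n 2; first by rewrite !s_small.
  by apply: double_inj; rewrite !s_double.
split; rewrite ?s_small //; [move=> n n2 | move=> n].
  have half k : (k < 2)%N -> (s_ n k R)%:R = n`!%:R / 2%:R :> rat.
    move=> k2; apply: (canRL (mulfK _)) => //.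
    by rewrite -natrM muln2 s_double // k2 mul1n.
  by rewrite !half.
rewrite /fps_add !fps_mul_constE /fps_const /fps_x.
(* The factor [1 + x] has no coefficient beyond degree 1, so only the [F] term survives for
   [n >= 2]; for [n < 2] the two halves [(1 - q)/2] and [(1 + q)/2] add up to 1. *)
have [n2|n2] := ltnP n 2; last first.
  by rewrite pattern_gf_large //; case: n n2 => [|[|n]] //= _; rewrite addr0 mulr0 add0r.
have -> : F n = 1 by case: n n2 => [|[]].
rewrite pattern_gf_small //.
have -> : (if n == 0 then 1 else 0) + (if n == 1 then 1 else 0) = 1 :> {poly rat}.
  by case: n n2 => [|[]] //= _; rewrite ?addr0 ?add0r.
rewrite !mulr1 -scalerDr addrACA addNr addr0 -mulr2n -scaler_nat scalerA mulVf //.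
by rewrite scale1r.
Qed.
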